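(* Consider the following two optimization problems. (MPEC) Over \(g\in\mathbb{R}^{n_v}\), \(B\in\{0,1\}^{n_v\times n_c}\), \(p\in\mathbb{R}^{n_l}\), \(q\in\mathbb{R}^{n_v}\), \(X,U\in\mathbb{R}^{n_l\times n_d}\), \(V\in\mathbb{R}^{n_n\times n_d}\), minimize \[ (c+p+D^\top q)^\top X\mathbf{1}_d+\omega\,\mathbf{1}_v^\top(K\odot B)\mathbf{1}_c \] subject to \[ EX=S,\quad X\mathbf{1}_d\le f,\quad DX\mathbf{1}_d\le g,\quad (c+p+D^\top q)\mathbf{1}_d^\top=E^\top V+U, \] \[ X\ge0,\ U\ge0,\ p\ge0,\ q\ge0,\quad c^\top X\mathbf{1}_d+f^\top p+g^\top q=\operatorname{tr}(V^\top S), \] \[ g=(G\odot B)\mathbf{1}_c,\quad B\mathbf{1}_c\le\mathbf{1}_v,\quad \mathbf{1}_v^\top(K\odot B)\mathbf{1}_c\le\gamma,\quad A\operatorname{vec}(B)\le b. \] (MILP\(_\mu\)), for a scalar \(\mu>0\). Over \(B\in\{0,1\}^{n_v\times n_c}\), \(p\in\mathbb{R}^{n_l}\), \(q\in\mathbb{R}^{n_v}\), \(Y\in\mathbb{R}^{n_v\times n_c}\), \(X,U\in\mathbb{R}^{n_l\times n_d}\), \(V\in\mathbb{R}^{n_n\times n_d}\), minimize \[ c^\top X\mathbf{1}_d+f^\top p+\mathbf{1}_v^\top Y\mathbf{1}_c+\omega\,\mathbf{1}_v^\top(K\odot B)\mathbf{1}_c \] subject to \[ EX=S,\quad X\mathbf{1}_d\le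 f,\quad DX\mathbf{1}_d\le (G\odot B)\mathbf{1}_c,\quad (c+p+D^\top q)\mathbf{1}_d^\top=E^\top V+U, \] \[ X\ge0,\ U\ge0,\ p\ge0,\ q\ge0,\quad c^\top X\mathbf{1}_d+f^\top p+\mathbf{1}_v^\top Y\mathbf{1}_c=\operatorname{tr}(V^\top S), \] \[ 0\le G\odot(q\mathbf{1}_c^\top)-Y\le\mu(\mathbf{1}_v\mathbf{1}_c^\top-B),\quad 0\le Y\le\mu B, \] \[ B\mathbf{1}_c\le\mathbf{1}_v,\quad \mathbf{1}_v^\top(K\odot B)\mathbf{1}_c\le\gamma,\quad A\operatorname{vec}(B)\le b. \] Then, for all sufficiently large \(\mu>0\), (MPEC) and (MILP\(_\mu\)) are equivalent in the following sense: they have the same optimal value (with value \(+\infty\) for an infeasible problem), and for every globally optimal solution \((B,p,q,Y,X,U,V)\) of (MILP\(_\mu\)), the tuple \((g,B,p,q,X,U,V)\) with \(g=(G\odot B)\mathbf{1}_c\) is a globally optimal solution of (MPEC).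
   Context: \(\odot\) is the Hadamard (entrywise) product; \(\mathbf{1}_d,\mathbf{1}_v,\mathbf{1}_c\) are the all-ones vectors in \(\mathbb{R}^{n_d},\mathbb{R}^{n_v},\mathbb{R}^{n_c}\); inequalities between vectors or matrices are elementwise; \(\operatorname{vec}:\mathbb{R}^{n_v\times n_c}\to\mathbb{R}^{n_vn_c}\) is the vectorization with \([\operatorname{vec}(B)]_{(i-1)n_c+j}=[B]_{ij}\). Network. \(\mathcal{N}=\{1,\dots,n_n\}\) is a set of nodes, \(\mathcal{V}=\{v(1),\dots,v(n_v)\}\subseteq\mathcal{N}\) the set of nodes containing a candidate vertiport, and \(\mathcal{L}=\{1,\dots,n_l\}\) a set of links. Each link is an ordered pair of distinct nodes (tail, head). Links \(1,\dots,n_g\) (\(n_g\le n_l\)) are ground links; links \(n_g+1,\dots,n_l\) are air links, and air links only join nodes of \(\mathcal{V}\). The node-edge incidence matrix \(E\in\mathbb{R}^{n_n\times n_l}\) has \([E]_{ik}=1\) if node \(i\) is the tail of link \(k\), \([E]_{ik}=-1\) if node \(i\) is the head of link \(k\), and \([E]_{ik}=0\) otherwise. The matrix \(D\in\mathbb{R}^{n_v\times n_l}\) has \([D]_{ik}=1\) if \(k\ge n_g+1\) and \([E]_{v(i),k}\neq 0\), and \([D]_{ik}=0\) otherwise. Demand. \(\{s(1),\dots,s(n_d)\}\subset\mathcal{N}\) are the destination nodes. The demand matrix \(S\in\mathbb{R}^{n_n\times n_d}\) has, for \(i\neq s(j)\), \([S]_{ij}\geq 0\) equal to the traffic demand from node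 \(i\) to node \(s(j)\), and \([S]_{s(j),j}=-\sum_{i\neq s(j)}[S]_{ij}\). Parameters. \(c\in\mathbb{R}^{n_l}\) is the free travel time vector, \(f\in\mathbb{R}_+^{n_l}\) the link capacity vector; \(G\in\mathbb{R}^{n_v\times n_c}\) is the matrix of candidate vertiport capacities, with strictly positive entries and \([G]_{i1}<[G]_{i2}<\dots<[G]_{i,n_c}\) for each \(i\); \(K\in\mathbb{R}^{n_v\times n_c}\) is the cost matrix; \(\gamma\in\mathbb{R}\) is the budget; \(\omega\ge 0\) is a weight; \(A\in\mathbb{R}^{n_b\times(n_vn_c)}\) and \(b\in\mathbb{R}^{n_b}\) encode logical constraints. Standing assumption. For the vertiport capacity vectors \(g\) under consideration (those of the form \(g=(G\odot B)\mathbf{1}_c\) with \(B\in\{0,1\}^{n_v\times n_c}\), \(B\mathbf{1}_c\le\mathbf{1}_v\)), the linear program \[ \text{minimize}_{X\in\mathbb{R}^{n_l\times n_d}}\ \ c^\top X\mathbf{1}_d\quad\text{subject to}\quad EX=S,\ X\ge0,\ X\mathbf{1}_d\le f,\ DX\mathbf{1}_d\le g \] is feasible and has a bounded optimal value. *)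

(* Defs.v *)
From HB Require Import structures.
From mathcomp Require Import all_boot all_order all_algebra.
From mathcomp Require Import boolp classical_sets reals constructive_ereal ereal.

Set Implicit Arguments.
Unset Strict Implicit.
Unset Printing Implicit Defensive.

Import Order.TTheory GRing.Theory Num.Theory.
Local Open Scope classical_set_scope.
Local Open Scope ring_scope.

Definition mxle (R : realType) m n (M N : 'M[R]_(m, n)) : Prop :=
  forall i j, M i j <= N i j.
Notation "M <=mx N" := (mxle M N) (at level 70, no associativity) : ring_scope.

Definition hadamard (R : realType) m n (M N : 'M[R]_(m, n)) : 'M[R]_(m, n) :=
  map2_mx *%R M N.
Notation "M \odot N" := (hadamard M N) (at level 40, left associativity) : ring_scope.

Definition ones (R : realType) n : 'cV[R]_n := const_mx 1.
Arguments ones {R n}.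

Definition binary_mx (R : realType) m n (M : 'M[R]_(m, n)) : Prop :=
  forall i j, M i j = 0 \/ M i j = 1.

(* [mxvec] lists the entries row by row. *)
Definition vecmx (R : realType) m n (M : 'M[R]_(m, n)) : 'cV[R]_(m * n) :=
  (mxvec M)^T.

Lemma val_mxvec_index m n (i : 'I_m) (j : 'I_n) :
  mxvec_index i j = (i * n + j)%N :> nat.
Proof.
rewrite /mxvec_index /= /enum_rank [enum_rank_in]unlock /insubd insubT /=.
  by rewrite cardE index_mem mem_enum.
move=> lt_ij; rewrite enumT unlock /= /prod_enum.
have index_pair (T1 T2 : eqType) (s1 : seq T1) (s2 : seq T2) x y :
    x \in s1 -> y \in s2 ->
  index (x, y) [seq (x1, x2) | x1 <- s1, x2 <- s2]
    = (index x s1 * size s2 + index y s2)%N.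
  move=> xs1 ys2; elim: s1 xs1 => //= z s1 IHs; rewrite inE index_cat size_map.
  have [<- _ | neq_zx] := eqVneq z x.
    rewrite (mem_map (fun u v => _)) ?ys2; last by move=> u v [].
    by rewrite mul0n index_map // => u v [].
  move=> /= /IHs ->.
  case: mapP => [[u _ [eq_xz]]|_]; first by rewrite eq_xz eqxx in neq_zx.
  by rewrite mulSn addnA.
by rewrite index_pair ?mem_enum // !index_enum_ord size_enum_ord.
Qed.

Lemma vecmxE (R : realType) m n (M : 'M[R]_(m, n)) i j :
  vecmx M (mxvec_index i j) 0 = M i j.
Proof. by rewrite mxE mxvecE. Qed.

Definition optimal_value (R : realType) (T : Type) (F : set T) (obj : T -> R) :
    \bar R :=
  ereal_inf [set (obj x)%:E | x in F].

Definition global_minimizer (R : realType) (T : Type) (F : set T)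
    (obj : T -> R) (x : T) : Prop :=
  F x /\ forall y, F y -> obj x <= obj y.

(* Nodes, candidate vertiports and links are numbered from 0, so the ground
   links are those with index below [ground_links]. *)
Record network (nn nv nl : nat) := Network {
  vertiport : 'I_nv -> 'I_nn;
  link_tail : 'I_nl -> 'I_nn;
  link_head : 'I_nl -> 'I_nn;
  ground_links : nat;
  vertiport_inj : injective vertiport;
  link_tail_neq_head : forall k, link_tail k != link_head k;
  ground_links_le : (ground_links <= nl)%N;
  air_link_vertiports : forall k : 'I_nl, (ground_links <= k)%N ->
    (exists i, link_tail k = vertiport i) /\
    (exists i, link_head k = vertiport i)
}.

Definition incidence (R : realType) nn nv nl (N : network nn nv nl) :
    'M[R]_(nn, nl) :=
  \matrix_(i, k) if i == link_tail N k then 1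
                 else if i == link_head N k then -1 else 0.

Definition air_incidence (R : realType) nn nv nl (N : network nn nv nl) :
    'M[R]_(nv, nl) :=
  \matrix_(i, k) if (ground_links N <= k)%N &&
                    (incidence R N (vertiport N i) k != 0) then 1 else 0.

Record planning (R : realType) (nn nv nl nd nc nb : nat) := Planning {
  net : network nn nv nl;
  destination : 'I_nd -> 'I_nn;
  demand : 'M[R]_(nn, nd);
  travel_time : 'cV[R]_nl;
  link_capacity : 'cV[R]_nl;
  port_capacity : 'M[R]_(nv, nc);
  port_cost : 'M[R]_(nv, nc);
  budget : R;
  weight : R;
  logic_mx : 'M[R]_(nb, nv * nc);
  logic_rhs : 'cV[R]_nb;
  destination_inj : injective destination;
  demand_ge0 : forall i j, i != destination j -> 0 <= demand i j;
  demand_destination : forall j,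
    demand (destination j) j = - \sum_(i | i != destination j) demand i j;
  link_capacity_ge0 : 0 <=mx link_capacity;
  port_capacity_gt0 : forall i j, 0 < port_capacity i j;
  port_capacity_incr : forall i (j1 j2 : 'I_nc), (j1 < j2)%N ->
    port_capacity i j1 < port_capacity i j2;
  weight_ge0 : 0 <= weight
}.

Record mpec_point (R : realType) (nn nv nl nd nc : nat) := MpecPoint {
  mpec_g : 'cV[R]_nv;
  mpec_B : 'M[R]_(nv, nc);
  mpec_p : 'cV[R]_nl;
  mpec_q : 'cV[R]_nv;
  mpec_X : 'M[R]_(nl, nd);
  mpec_U : 'M[R]_(nl, nd);
  mpec_V : 'M[R]_(nn, nd)
}.

Record milp_point (R : realType) (nn nv nl nd nc : nat) := MilpPoint {
  milp_B : 'M[R]_(nv, nc);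
  milp_p : 'cV[R]_nl;
  milp_q : 'cV[R]_nv;
  milp_Y : 'M[R]_(nv, nc);
  milp_X : 'M[R]_(nl, nd);
  milp_U : 'M[R]_(nl, nd);
  milp_V : 'M[R]_(nn, nd)
}.

Section Problems.
Context (R : realType) (nn nv nl nd nc nb : nat).
Context (P : planning R nn nv nl nd nc nb).

Local Notation E := (incidence R (net P)).
Local Notation D := (air_incidence R (net P)).
Local Notation S := (demand P).
Local Notation c := (travel_time P).
Local Notation f := (link_capacity P).
Local Notation G := (port_capacity P).
Local Notation K := (port_cost P).
Local Notation gamma := (budget P).
Local Notation omega := (weight P).
Local Notation A := (logic_mx P).
Local Notation b := (logic_rhs P).

Definition selected_capacity (B : 'M[R]_(nv, nc)) : 'cV[R]_nv :=
  (G \odot B) *m ones.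

Definition selected_cost (B : 'M[R]_(nv, nc)) : R :=
  (ones^T *m (K \odot B) *m ones) 0 0.

Definition lp_feasible (g : 'cV[R]_nv) : set 'M[R]_(nl, nd) :=
  [set X | [/\ E *m X = S, 0 <=mx X, X *m ones <=mx f
             & D *m X *m ones <=mx g]].

Definition lp_objective (X : 'M[R]_(nl, nd)) : R := (c^T *m X *m ones) 0 0.

Definition lp_feasible_bounded (g : 'cV[R]_nv) : Prop :=
  lp_feasible g !=set0 /\
  optimal_value (lp_feasible g) lp_objective \is a fin_num.

Definition mpec_objective (x : mpec_point R nn nv nl nd nc) : R :=
  let: MpecPoint g B p q X U V := x in
  ((c + p + D^T *m q)^T *m X *m ones) 0 0 + omega * selected_cost B.

Definition mpec_feasible : set (mpec_point R nn nv nl nd nc) :=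
  [set x | let: MpecPoint g B p q X U V := x in
    binary_mx B /\
    [/\ E *m X = S, X *m ones <=mx f, D *m X *m ones <=mx g
      & (c + p + D^T *m q) *m ones^T = E^T *m V + U] /\
    [/\ 0 <=mx X, 0 <=mx U, 0 <=mx p & 0 <=mx q] /\
    (c^T *m X *m ones) 0 0 + (f^T *m p) 0 0 + (g^T *m q) 0 0
      = \tr (V^T *m S) /\
    [/\ g = (G \odot B) *m ones, B *m ones <=mx ones, selected_cost B <= gamma
      & A *m vecmx B <=mx b]].

Definition milp_objective (x : milp_point R nn nv nl nd nc) : R :=
  let: MilpPoint B p q Y X U V := x in
  (c^T *m X *m ones) 0 0 + (f^T *m p) 0 0 + (ones^T *m Y *m ones) 0 0
    + omega * selected_cost B.

Definition milp_feasible (mu : R) : set (milp_point R nn nv nl nd nc) :=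
  [set x | let: MilpPoint B p q Y X U V := x in
    binary_mx B /\
    [/\ E *m X = S, X *m ones <=mx f, D *m X *m ones <=mx (G \odot B) *m ones
      & (c + p + D^T *m q) *m ones^T = E^T *m V + U] /\
    [/\ 0 <=mx X, 0 <=mx U, 0 <=mx p & 0 <=mx q] /\
    (c^T *m X *m ones) 0 0 + (f^T *m p) 0 0 + (ones^T *m Y *m ones) 0 0
      = \tr (V^T *m S) /\
    [/\ 0 <=mx G \odot (q *m ones^T) - Y,
        G \odot (q *m ones^T) - Y <=mx mu *: (ones *m ones^T - B),
        0 <=mx Y & Y <=mx mu *: B] /\
    [/\ B *m ones <=mx ones, selected_cost B <= gamma
      & A *m vecmx B <=mx b]].

End Problems.

(* Main.v *)
From HB Require Import structures.
Require Import Defs.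
From mathcomp Require Import all_boot all_order all_algebra.
From mathcomp Require Import boolp classical_sets reals constructive_ereal ereal.
From mathcomp Require Import ring lra.

Set Implicit Arguments.
Unset Strict Implicit.
Unset Printing Implicit Defensive.

Import Order.TTheory GRing.Theory Num.Theory.
Local Open Scope ring_scope.

(** For binary [B] the big-M constraints force [Y i j = G i j * B i j * q i],
    so (MILP_mu) is (MPEC) with the extra constraints [G i j * q i <= mu], and
    complementary slackness makes the two objectives agree.  The set of optimal
    dual prices may be unbounded, but for fixed [B] the problem (MPEC) is a
    linear program bounded below, hence its minimum is attained at some point,
    with a finite [q].  There are finitely many [B], so a single [mu] dominates
    the entries [G i j * q i] of one minimizer for each of them. *)

(** * Fourier-Motzkin elimination and attainment of linear minima *)

Lemma exists_between (R : realFieldType) (I : finType) (P Q : pred I)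
    (l u : I -> R) :
  (forall i j, P i -> Q j -> l i <= u j) ->
  exists y, (forall i, P i -> l i <= y) /\ (forall j, Q j -> y <= u j).
Proof.
move=> le_lu; have [i0 Pi0|noP] := pickP P.
  case: (arg_maxP l Pi0) => i Pi max_i.
  by exists (l i); split=> [j /max_i|j Qj]; last exact: le_lu.
have [j0 Qj0|noQ] := pickP Q; last first.
  by exists 0; split=> i; rewrite ?noP ?noQ.
case: (arg_minP u Qj0) => j Qj min_j.
by exists (u j); split=> i; rewrite ?noP // => /min_j.
Qed.

(** Constraints with [a i > 0] bound [y] from below, those with [a j < 0] from above. A suitable [y]
    exists exactly when each lower bound is at most each upper bound, which is written here with
    denominators cleared. *)
Lemma fourier_motzkin_step (R : realFieldType) (I : finType) (a v : I -> R) :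
  (exists y, forall i, 0 <= v i + a i * y) <->
  (forall i, a i = 0 -> 0 <= v i) /\
  (forall i j, 0 < a i -> a j < 0 -> 0 <= a i * v j - a j * v i).
Proof.
split=> [[y y_sol]|[sol0 sol_pair]].
  split=> [i ai0|i j ai_gt0 aj_lt0].
    by have := y_sol i; rewrite ai0 mul0r addr0.
  have naj_ge0 : 0 <= - a j by rewrite oppr_ge0 ltW.
  by have := mulr_ge0 (ltW ai_gt0) (y_sol j);
    have := mulr_ge0 naj_ge0 (y_sol i); lra.
have [|y [y_ge y_le]] := @exists_between R I (fun i => 0 < a i)
    (fun j => a j < 0) (fun i => - (v i / a i)) (fun j => - (v j / a j)).
  move=> i j ai_gt0 aj_lt0; have := sol_pair i j ai_gt0 aj_lt0.
  rewrite lerN2 ler_ndivrMr // mulrAC ler_pdivrMr //; lra.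
exists y => i; case: (ltgtP (a i) 0) => [ai_lt0|ai_gt0|ai0].
- by move: (y_le i ai_lt0); rewrite -mulNr ler_ndivlMr //; lra.
- by move: (y_ge i ai_gt0); rewrite -mulNr ler_pdivrMr //; lra.
- by rewrite ai0 mul0r addr0 sol0.
Qed.

(** Unknowns are eliminated one at a time, the last one first, while the parameter [t] is kept: the
    result is the projection onto the [t]-axis. The unknowns form a function on [nat], so that
    assignments have the same type for every [n]. *)
Lemma fourier_motzkin (R : realFieldType) n (I : finType)
    (a : I -> nat -> R) (d b : I -> R) :
  exists (J : finType) (d' b' : J -> R), forall t,
    (exists x : nat -> R,
       forall i, 0 <= \sum_(k < n) a i k * x k + d i * t + b i) <->
    (forall j, 0 <= d' j * t + b' j).
Proof.
elim: n I a d b => [|n IHn] I a d b.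
  exists I, d, b => t; split=> [[x sol] i|sol].
    by have := sol i; rewrite big_ord0 add0r.
  by exists (fun=> 0) => i; rewrite big_ord0 add0r.
(* The new constraints are indexed by old ones (those free of the eliminated unknown) and by pairs
   of a lower and an upper bound. Other indices give the trivial constraint [0 <= 0], which avoids a
   subtype of indices. *)
pose elim_col (c : I -> R) (k : I + I * I) : R :=
  match k with
  | inl i => if a i n == 0 then c i else 0
  | inr (i, j) =>
      if (0 < a i n) && (a j n < 0) then a i n * c j - a j n * c i else 0
  end.
have [J [d' [b' sol'E]]] :=
  IHn _ (fun k m => elim_col (a^~ m) k) (elim_col d) (elim_col b).
exists J, d', b' => t; rewrite -sol'E.
pose v (x : nat -> R) i := \sum_(k < n) a i k * x k + d i * t + b i.
(* [elim_col] is linear in the column, so eliminating column by column and then evaluating at [x] is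
   the same as eliminating the evaluated constraints. *)
have elimE (x : nat -> R) k : \sum_(m < n) elim_col (a^~ m) k * x m + elim_col d k * t
    + elim_col b k = elim_col (v x) k.
  case: k => [i|[i j]] /=; case: ifP => _ //; last first.
  - by rewrite big1 => [|m _]; rewrite ?mul0r ?addr0.
  - have -> : \sum_(m < n) (a i n * a j m - a j n * a i m) * x m =
        a i n * (\sum_(m < n) a j m * x m) - a j n * (\sum_(m < n) a i m * x m).
      by rewrite !mulr_sumr -sumrB; apply: eq_bigr => m _; ring.
    by rewrite /v; ring.
  - by rewrite big1 => [|m _]; rewrite ?mul0r ?addr0.
have stepE x : (exists y, forall i, 0 <= v x i + a i n * y) <->
    (forall k, 0 <= elim_col (v x) k).
  rewrite fourier_motzkin_step; split=> [[sol0 sol2] [i|[i j]] /=|sol].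
  - by case: eqP => // /sol0.
  - by case: ifP => // /andP[]; exact: sol2.
  - split=> [i ai0|i j ai aj]; first by have := sol (inl i); rewrite /= ai0 eqxx.
    by have := sol (inr (i, j)); rewrite /= ai aj.
split=> [[x sol]|[x sol]].
  exists x => k; rewrite elimE; move: k; apply/stepE; exists (x n) => i.
  by have := sol i; rewrite big_ord_recr /= /v; lra.
have /stepE[y sol_y] k : 0 <= elim_col (v x) k by rewrite -elimE.
exists (fun k => if k == n then y else x k) => i.
rewrite big_ord_recr /= eqxx.
under eq_bigr => k _ do rewrite (ltn_eqF (ltn_ord k)).
by have := sol_y i; rewrite /v; lra.
Qed.

(** The minimum is the largest of the lower bounds [- b j / d j] with [d j > 0]. Such a [j] must
    exist, since otherwise the solutions would be closed downwards and go below [m]. *)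
Lemma min_affine_halflines (R : realFieldType) (J : finType) (d b : J -> R)
    (m t0 : R) :
  (forall j, 0 <= d j * t0 + b j) ->
  (forall t, (forall j, 0 <= d j * t + b j) -> m <= t) ->
  exists2 t1, (forall j, 0 <= d j * t1 + b j) &
    forall t, (forall j, 0 <= d j * t + b j) -> t1 <= t.
Proof.
move=> sol0 lb_m; have [j0 dj0|dle0] := pickP (fun j => 0 < d j).
  case: (@arg_maxP _ _ J j0 (fun j => 0 < d j) (fun j => - b j / d j) dj0) => j dj max_j.
  have lb t : (forall i, 0 <= d i * t + b i) -> - b j / d j <= t.
    by move=> /(_ j); rewrite ler_pdivrMr //; lra.
  exists (- b j / d j) => // i; have [di_gt0|di_le0] := ltP 0 (d i).
    by have /= := max_j i di_gt0; rewrite ler_pdivrMr //; lra.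
  (* A constraint with [d i <= 0] holds at [t0], hence also at the smaller candidate. *)
  by have := ler_wnM2l di_le0 (lb t0 sol0); have := sol0 i; lra.
have /lb_m : forall j, 0 <= d j * (Num.min t0 (m - 1)) + b j.
  move=> j; have dj : d j <= 0 by rewrite leNgt dle0.
  have := ler_wnM2l dj (_ : Num.min t0 (m - 1) <= t0).
  by rewrite ge_min lexx => /(_ isT); have := sol0 j; lra.
by rewrite le_min => /andP[_]; lra.
Qed.

Definition polyhedron (R : realFieldType) (W : vectType R) (F : W -> Prop) : Prop :=
  exists (I : finType) (l : I -> {scalar W}) (b : I -> R),
    forall w, F w <-> forall i, l i w <= b i.

(** The values [t] that are at least [obj w] for some [w] in [F] form a projection of a polyhedron.
    By elimination they are cut out by finitely many half-lines, so being bounded below they have a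
    least element, and a [w] that witnesses it is a minimizer. *)
Lemma lp_min_attained (R : realFieldType) (W : vectType R) (F : W -> Prop)
    (obj : {scalar W}) (m : R) (w0 : W) :
  polyhedron F -> F w0 -> (forall w, F w -> m <= obj w) ->
  exists2 w, F w & forall w', F w' -> obj w <= obj w'.
Proof.
move=> [I [l [b FE]]] Fw0 lb_m.
pose e := vbasis {:W}; pose n := \dim {:W}.
pose comb (x : nat -> R) : W := \sum_(k < n) x k *: e`_k.
have comb_onto w : exists x, w = comb x.
  exists (fun k => if insub k is Some i then coord e i w else 0).
  rewrite [LHS](coord_vbasis (memvf w)); apply: eq_bigr => k _.
  by rewrite valK.
have scalar_comb (h : {scalar W}) x : h (comb x) = \sum_(k < n) h e`_k * x k.
  by rewrite linear_sum; apply: eq_bigr => k _; rewrite linearZ /= mulrC.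
(* The system in (x, t) says that [w = comb x] lies in [F] and [obj w <= t]. *)
have [J [d' [b' solE]]] := @fourier_motzkin R n (option I)
  (fun i k => if i is Some j then - l j e`_k else - obj e`_k)
  (fun i => if i is Some _ then 0 else 1) (fun i => if i is Some j then b j else 0).
have {}solE t : (forall j, 0 <= d' j * t + b' j) <->
    exists w, F w /\ obj w <= t.
  rewrite -solE; split=> [[x sol]|[w [/FE Fw le_t]]].
    exists (comb x); split.
      apply/FE => i; rewrite scalar_comb; have := sol (Some i).
      by under eq_bigr => k _ do rewrite mulNr; rewrite sumrN; lra.
    rewrite scalar_comb; have := sol None.
    by under eq_bigr => k _ do rewrite mulNr; rewrite sumrN; lra.
  have [x wE] := comb_onto w; exists x => -[i|].
    under eq_bigr => k _ do rewrite mulNr.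
    by rewrite sumrN -scalar_comb -wE; have := Fw i; lra.
  under eq_bigr => k _ do rewrite mulNr.
  by rewrite sumrN -scalar_comb -wE; lra.
have [||t1 /solE[w [Fw le_t1]] min_t1] :=
    @min_affine_halflines R J d' b' m (obj w0).
- by apply/solE; exists w0.
- by move=> t /solE[w [/lb_m]]; exact: le_trans.
exists w => // w' Fw'; apply: le_trans le_t1 (min_t1 _ _).
by apply/solE; exists w'.
Qed.

(** * Polyhedra defined by linear matrix constraints *)

Lemma polyhedronI (R : realFieldType) (W : vectType R) (F1 F2 : W -> Prop) :
  polyhedron F1 -> polyhedron F2 ->
  polyhedron (fun w => F1 w /\ F2 w).
Proof.
move=> [I1 [l1 [b1 F1E]]] [I2 [l2 [b2 F2E]]].
exists (I1 + I2)%type, (fun i => match i with inl i => l1 i | inr i => l2 i end),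
  (fun i => match i with inl i => b1 i | inr i => b2 i end) => w.
rewrite F1E F2E; split=> [[sol1 sol2] []//|sol].
by split=> i; [apply: (sol (inl i)) | apply: (sol (inr i))].
Qed.

Lemma eq_polyhedron (R : realFieldType) (W : vectType R) (F1 F2 : W -> Prop) :
  (forall w, F1 w <-> F2 w) -> polyhedron F1 -> polyhedron F2.
Proof.
by move=> F12 [I [l [b F1E]]]; exists I, l, b => w; rewrite -F12 F1E.
Qed.

Lemma polyhedron_le (R : realFieldType) (W : vectType R) (J : finType)
    (h : J -> W -> R) (r : J -> R) :
  (forall j, scalar (h j)) -> polyhedron (fun w => forall j, h j w <= r j).
Proof.
move=> scalar_h.
by exists J, (fun j => HB.pack_for {scalar W} (h j)
  (GRing.isLinear.Build _ _ _ _ _ (scalar_h j))), r.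
Qed.

Lemma polyhedron_eq (R : realFieldType) (W : vectType R) (J : finType)
    (h : J -> W -> R) (r : J -> R) :
  (forall j, scalar (h j)) -> polyhedron (fun w => forall j, h j w = r j).
Proof.
move=> scalar_h; have scalarN_h j : scalar (fun w => - h j w).
  by move=> a u v; rewrite scalar_h; ring.
apply: eq_polyhedron (polyhedronI (polyhedron_le r scalar_h)
  (polyhedron_le (fun j => - r j) scalarN_h)) => w.
split=> [[le_h ge_h] j|h_eq]; last by split=> j; rewrite h_eq.
by apply/le_anti; rewrite le_h -lerN2 ge_h.
Qed.

(** Unlike [mxE], this and [scalemxE] leave matrix products folded. *)
Lemma addmxE (R : nmodType) m n (M N : 'M[R]_(m, n)) i j :
  (M + N) i j = M i j + N i j.
Proof. by rewrite mxE. Qed.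

Lemma scalemxE (R : pzRingType) m n a (M : 'M[R]_(m, n)) i j :
  (a *: M) i j = a * M i j.
Proof. by rewrite mxE. Qed.

Lemma linear_entry (R : comPzRingType) (W : lmodType R) m n
    (h : W -> 'M[R]_(m, n)) i j : linear h -> scalar (fun w => h w i j).
Proof. by move=> linear_h a u v; rewrite linear_h addmxE scalemxE. Qed.

Lemma polyhedron_mxle (R : realType) (W : vectType R) m n
    (h : W -> 'M[R]_(m, n)) (M : 'M[R]_(m, n)) :
  linear h -> polyhedron (fun w => h w <=mx M).
Proof.
move=> linear_h; have := @polyhedron_le R W ('I_m * 'I_n)%type
  (fun k w => h w k.1 k.2) (fun k => M k.1 k.2).
case/(_ (fun k => linear_entry k.1 k.2 linear_h)) => I [l [b lE]].
exists I, l, b => w; rewrite -lE.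
by split=> [le_hM [i j]|le_hM i j]; [exact: le_hM | exact: (le_hM (i, j))].
Qed.

Lemma polyhedron_mxeq (R : realType) (W : vectType R) m n
    (h : W -> 'M[R]_(m, n)) (M : 'M[R]_(m, n)) :
  linear h -> polyhedron (fun w => h w = M).
Proof.
move=> linear_h; have := @polyhedron_eq R W ('I_m * 'I_n)%type
  (fun k w => h w k.1 k.2) (fun k => M k.1 k.2).
case/(_ (fun k => linear_entry k.1 k.2 linear_h)) => I [l [b lE]].
exists I, l, b => w; rewrite -lE.
split=> [->//|eq_hM]; apply/matrixP => i j; exact: (eq_hM (i, j)).
Qed.

(** * Monotonicity and sign of inner products *)

Lemma dotmxC (R : comPzRingType) n (x y : 'cV[R]_n) :
  (x^T *m y) 0 0 = (y^T *m x) 0 0.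
Proof. by rewrite !mxE; apply: eq_bigr => i _; rewrite !mxE mulrC. Qed.

Lemma ler_dotmx (R : realType) n (p x y : 'cV[R]_n) :
  0 <=mx p -> x <=mx y -> (p^T *m x) 0 0 <= (p^T *m y) 0 0.
Proof.
move=> p_ge0 le_xy; rewrite !mxE; apply: ler_sum => i _; rewrite !mxE.
by apply: ler_wpM2l => //; have := p_ge0 i 0; rewrite mxE.
Qed.

Lemma dotmx_ge0 (R : realType) n (p x : 'cV[R]_n) :
  0 <=mx p -> 0 <=mx x -> 0 <= (p^T *m x) 0 0.
Proof. by move=> p_ge0 /(ler_dotmx p_ge0); rewrite mulmx0 mxE. Qed.

Lemma mxtrace_ge0 (R : realType) m n (M N : 'M[R]_(m, n)) :
  0 <=mx M -> 0 <=mx N -> 0 <= \tr (M^T *m N).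
Proof.
move=> M_ge0 N_ge0; apply: sumr_ge0 => i _; rewrite mxE; apply: sumr_ge0 => j _.
rewrite mxE; apply: mulr_ge0; first by have := M_ge0 j i; rewrite mxE.
by have := N_ge0 j i; rewrite mxE.
Qed.

(** * Strong duality and the linear program of a fixed design *)

Section Planning.
Context (R : realType) (nn nv nl nd nc nb : nat).
Context (P : planning R nn nv nl nd nc nb).

Local Notation E := (incidence R (net P)).
Local Notation D := (air_incidence R (net P)).
Local Notation S := (demand P).
Local Notation c := (travel_time P).
Local Notation f := (link_capacity P).
Local Notation G := (port_capacity P).

(* Both inequalities of weak duality are tight under the strong duality
   constraint, which linearizes the bilinear objective. *)
Lemma mpec_objective_linear g B p q X U V :
  mpec_feasible P (MpecPoint g B p q X U V) ->
  mpec_objective P (MpecPoint g B p q X U V) =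
    (c^T *m X *m ones) 0 0 + (f^T *m p) 0 0 + (g^T *m q) 0 0
      + weight P * selected_cost P B.
Proof.
case=> _ [[EX_S X1_f DX1_g price] [[X_ge0 U_ge0 p_ge0 q_ge0] [duality _]]] /=.
congr (_ + _).
(* Pair the price equation with [X] and use [E *m X = S]. *)
have trE : \tr (V^T *m S) =
    ((c + p + D^T *m q)^T *m X *m ones) 0 0 - \tr (U^T *m X).
  rewrite -EX_S mulmxA -[V^T *m E]trmxK trmx_mul trmxK.
  have -> : E^T *m V = (c + p + D^T *m q) *m ones^T - U by rewrite price addrK.
  rewrite linearB /= mulmxBl linearB /= trmx_mul trmxK -(mulmxA ones).
  by rewrite (mxtrace_mulC ones) trace_mx11.
have piE : ((c + p + D^T *m q)^T *m X *m ones) 0 0 = (c^T *m X *m ones) 0 0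
    + (p^T *m (X *m ones)) 0 0 + (q^T *m (D *m X *m ones)) 0 0.
  by rewrite !linearD /= trmx_mul trmxK !mulmxDl !addmxE !mulmxA.
(* The objective is at most the linear cost, which by [duality] and [trE] is the objective minus
   [\tr (U^T *m X)], hence at most the objective: all are equal. *)
have := mxtrace_ge0 U_ge0 X_ge0; have := ler_dotmx p_ge0 X1_f.
have := ler_dotmx q_ge0 DX1_g; rewrite (dotmxC p f) (dotmxC q g); lra.
Qed.

(** With [g] and [B] fixed, the constraints on the other variables are linear, and on feasible
    points the objective is the linear [cost] plus a constant. This cost is at least [m] because
    [f^T *m p] and [g^T *m q] are nonnegative, so [lp_min_attained] applies. *)
Lemma mpec_fixed_design_min g B p q X U V m :
  0 <=mx g ->
  (forall X', lp_feasible P g X' -> m <= lp_objective P X') ->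
  mpec_feasible P (MpecPoint g B p q X U V) ->
  exists p' q' X' U' V',
    mpec_feasible P (MpecPoint g B p' q' X' U' V') /\
    forall p'' q'' X'' U'' V'',
      mpec_feasible P (MpecPoint g B p'' q'' X'' U'' V'') ->
      mpec_objective P (MpecPoint g B p' q' X' U' V') <=
        mpec_objective P (MpecPoint g B p'' q'' X'' U'' V'').
Proof.
move=> g_ge0 lb_m feas0.
have [B_bin [_ [_ [_ design]]]] := feas0.
pose W : vectType R :=
  ('cV[R]_nl * 'cV[R]_nv * 'M[R]_(nl, nd) * 'M[R]_(nl, nd) * 'M[R]_(nn, nd))%type.
pose wp (w : W) := w.1.1.1.1; pose wq (w : W) := w.1.1.1.2.
pose wX (w : W) := w.1.1.2; pose wU (w : W) := w.1.2; pose wV (w : W) := w.2.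
pose cost w :=
  (c^T *m wX w *m ones) 0 0 + (f^T *m wp w) 0 0 + (g^T *m wq w) 0 0.
have linear_mulmx k l (h : W -> 'M[R]_(k, l)) l' (M : 'M[R]_(l', k)) :
    linear h -> linear (fun w => M *m h w).
  by move=> linear_h a u v; rewrite linear_h mulmxDr -scalemxAr.
have linear_mulmxr k l (h : W -> 'M[R]_(k, l)) l' (M : 'M[R]_(l, l')) :
    linear h -> linear (fun w => h w *m M).
  by move=> linear_h a u v; rewrite linear_h mulmxDl -scalemxAl.
have linear_add k l (h1 h2 : W -> 'M[R]_(k, l)) :
    linear h1 -> linear h2 -> linear (fun w => h1 w + h2 w).
  by move=> lin1 lin2 a u v; rewrite lin1 lin2 scalerDr addrACA.
have linear_opp k l (h : W -> 'M[R]_(k, l)) :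
    linear h -> linear (fun w => - h w).
  by move=> linear_h a u v; rewrite linear_h opprD scalerN.
have lin_p : linear wp by [].
have lin_q : linear wq by [].
have lin_X : linear wX by [].
have lin_U : linear wU by [].
have lin_V : linear wV by [].
have scalar_cost : scalar cost.
  move=> a u v; rewrite /cost lin_X lin_p lin_q !mulmxDr mulmxDl.
  by rewrite -!scalemxAr -scalemxAl !addmxE !scalemxE; ring.
have scalar_gap : scalar (fun w => cost w - \tr ((wV w)^T *m S)).
  move=> a u v; rewrite scalar_cost lin_V linearP mulmxDl -scalemxAl linearP /=.
  by ring.
pose F w := mpec_feasible P (MpecPoint g B (wp w) (wq w) (wX w) (wU w) (wV w)).
have poly_F : polyhedron F.
  have poly_flow := polyhedron_mxeq S (linear_mulmx _ _ _ _ E lin_X).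
  have poly_cap := polyhedron_mxle f (linear_mulmxr _ _ _ _ ones lin_X).
  have poly_port := polyhedron_mxle g
    (linear_mulmxr _ _ _ _ ones (linear_mulmx _ _ _ _ D lin_X)).
  (* The price equation with all unknowns moved to the left; [priceE] below converts it back. *)
  have poly_price := polyhedron_mxeq (- (c *m (ones : 'cV[R]_nd)^T))
    (linear_add _ _ _ _ (linear_add _ _ _ _ (linear_mulmxr _ _ _ _ ones^T
      (linear_add _ _ _ _ lin_p (linear_mulmx _ _ _ _ D^T lin_q)))
      (linear_opp _ _ _ (linear_mulmx _ _ _ _ E^T lin_V)))
      (linear_opp _ _ _ lin_U)).
  have poly_gap := polyhedron_eq (fun=> 0) (fun _ : unit => scalar_gap).
  have poly_ge0 k l (h : W -> 'M[R]_(k, l)) :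
      linear h -> polyhedron (fun w => 0 <=mx h w).
    move=> /linear_opp /(polyhedron_mxle 0); apply: eq_polyhedron => w.
    by split=> le_h i j; have := le_h i j; rewrite !mxE ?oppr_le0.
  apply: eq_polyhedron (polyhedronI (polyhedronI (polyhedronI poly_flow poly_cap)
    (polyhedronI poly_port poly_price)) (polyhedronI poly_gap
    (polyhedronI (polyhedronI (poly_ge0 _ _ _ lin_X) (poly_ge0 _ _ _ lin_U))
    (polyhedronI (poly_ge0 _ _ _ lin_p) (poly_ge0 _ _ _ lin_q))))) => w.
  have priceE : (wp w + D^T *m wq w) *m ones^T - E^T *m wV w - wU w
      = - (c *m (ones : 'cV[R]_nd)^T) <->
      (c + wp w + D^T *m wq w) *m ones^T = E^T *m wV w + wU w.
    rewrite -(addrA c) (mulmxDl c) -addrA -opprD.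
    split=> [/(congr1 (fun M => c *m ones^T + M + (E^T *m wV w + wU w)))|<-].
      by rewrite subrr add0r -!addrA addNr addr0.
    by rewrite opprD addrCA subrr addr0.
  rewrite priceE; split.
    case=> [[[? ?] [? ?]] [/(_ tt)/subr0_eq gap [[? ?] [? ?]]]].
    by split=> //; split=> //; split=> //; split.
  case=> _ [[? ? ? ?] [[? ? ? ?] [gap _]]]; do !split=> //.
  by move=> _; rewrite /cost gap subrr.
pose obj : {scalar W} :=
  HB.pack_for {scalar W} cost (GRing.isLinear.Build _ _ _ _ _ scalar_cost).
have lb_cost w : F w -> m <= obj w.
  case=> _ [[? ? ? _] [[? _ p_ge0 q_ge0] _]].
  have : m <= lp_objective P (wX w) by apply: lb_m.
  have := dotmx_ge0 (@link_capacity_ge0 _ _ _ _ _ _ _ P) p_ge0.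
  by have := dotmx_ge0 g_ge0 q_ge0; rewrite /lp_objective /= /cost; lra.
have [w Fw min_w] := lp_min_attained (w0 := (p, q, X, U, V) : W) poly_F feas0 lb_cost.
exists (wp w), (wq w), (wX w), (wU w), (wV w); split=> // p'' q'' X'' U'' V'' feas.
(* Both points share [B], so the design cost cancels. *)
rewrite !mpec_objective_linear // lerD2r.
exact: (min_w (p'', q'', X'', U'', V'')).
Qed.

(** * Passing between the two problems *)

Lemma selected_capacity_ge0 B : binary_mx B -> 0 <=mx selected_capacity P B.
Proof.
move=> B_bin i j; rewrite !mxE; apply: sumr_ge0 => k _; rewrite !mxE mulr1.
apply: mulr_ge0; first exact/ltW/port_capacity_gt0.
by case: (B_bin i k) => ->.
Qed.

(** The decisive bounds are those where [mu] is multiplied by zero: [B i j = 0] gives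
    [0 <= Y i j <= 0], and [B i j = 1] gives [0 <= G i j * q i - Y i j <= 0]. Hence the identity
    holds for every [mu]. *)
Lemma milp_feasible_linearized mu B p q Y X U V :
  milp_feasible P mu (MilpPoint B p q Y X U V) ->
  Y = G \odot B \odot (q *m ones^T).
Proof.
case=> B_bin [_ [_ [_ [[GqY_ge0 GqY_le Y_ge0 Y_le] _]]]].
apply/matrixP => i j; have := GqY_ge0 i j; have := GqY_le i j.
have := Y_ge0 i j; have := Y_le i j; rewrite !mxE !big_ord1 !mxE.
case: (B_bin i j) => ->; rewrite ?(mulr0, mulr1, subrr); lra.
Qed.

Lemma sum_linearized B (q : 'cV[R]_nv) :
  (ones^T *m (G \odot B \odot (q *m ones^T)) *m ones) 0 0
    = ((selected_capacity P B)^T *m q) 0 0.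
Proof.
rewrite -mulmxA !mxE; apply: eq_bigr => i _; rewrite !mxE mul1r mulr_suml.
by apply: eq_bigr => j _; rewrite !mxE big_ord1 !mxE !mulr1.
Qed.

Lemma milp_to_mpec mu B p q Y X U V :
  milp_feasible P mu (MilpPoint B p q Y X U V) ->
  mpec_feasible P (MpecPoint (selected_capacity P B) B p q X U V) /\
  mpec_objective P (MpecPoint (selected_capacity P B) B p q X U V)
    = milp_objective P (MilpPoint B p q Y X U V).
Proof.
move=> feas; have YE := milp_feasible_linearized feas.
have YsumE : (ones^T *m Y *m ones) 0 0 = ((selected_capacity P B)^T *m q) 0 0.
  by rewrite YE sum_linearized.
have mpec_feas :
    mpec_feasible P (MpecPoint (selected_capacity P B) B p q X U V).
  case: feas => ? [? [? [duality [_ [? ? ?]]]]].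
  by do 3!split=> //; split; first by rewrite -YsumE.
by split=> //; rewrite mpec_objective_linear //= YsumE.
Qed.

(** The bound by [mu] serves both values of [B i j]: it bounds [G i j * q i - Y i j] when
    [B i j = 0] and [Y i j] when [B i j = 1]. *)
Lemma mpec_to_milp mu g B p q X U V :
  mpec_feasible P (MpecPoint g B p q X U V) ->
  (forall i j, G i j * q i 0 <= mu) ->
  exists2 Y, milp_feasible P mu (MilpPoint B p q Y X U V) &
    milp_objective P (MilpPoint B p q Y X U V)
      = mpec_objective P (MpecPoint g B p q X U V).
Proof.
move=> feas le_mu; exists (G \odot B \odot (q *m ones^T)); last first.
  rewrite mpec_objective_linear //= sum_linearized.
  by case: feas => _ [_ [_ [_ [-> _ _ _]]]].
case: feas => B_bin [flow [signs [duality [gE B1 cost logic]]]].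
have [_ _ _ q_ge0] := signs.
split=> //; split; first by rewrite -gE.
split=> //; split; first by rewrite sum_linearized /selected_capacity -gE.
have Gq_ge0 i j : 0 <= G i j * q i 0.
  apply: mulr_ge0; first exact/ltW/port_capacity_gt0.
  by have := q_ge0 i 0; rewrite mxE.
split=> //; split=> i j; rewrite !mxE !big_ord1 !mxE;
  have := Gq_ge0 i j; have := le_mu i j; case: (B_bin i j) => ->; lra.
Qed.

(** Each [x] is replaced by the minimizer chosen for its own design. This domination covers an
    infeasible (MPEC) without a separate case. *)
Lemma mpec_bounded_dual_solution :
  (forall B : 'M[R]_(nv, nc), binary_mx B -> B *m ones <=mx ones ->
     lp_feasible_bounded P (selected_capacity P B)) ->
  exists2 mu0 : R, 0 < mu0 & forall x, mpec_feasible P x ->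
    exists x', [/\ mpec_feasible P x', mpec_objective P x' <= mpec_objective P x
      & forall i j, G i j * mpec_q x' i 0 <= mu0].
Proof.
move=> lp_bounded.
(* Boolean matrices form a finite type, over which bounds can be summed. *)
pose design (b : 'M[bool]_(nv, nc)) : 'M[R]_(nv, nc) := map_mx (fun t : bool => t%:R) b.
pose good b m := forall x, mpec_feasible P x -> mpec_B x = design b ->
  exists x', [/\ mpec_feasible P x', mpec_objective P x' <= mpec_objective P x
    & forall i j, G i j * mpec_q x' i 0 <= m].
have good_ex b : exists m, good b m.
  have [[x0 [feas0 x0B]]|no_x] :=
    pselect (exists x, mpec_feasible P x /\ mpec_B x = design b); last first.
    (* A design without feasible points admits any bound. *)
    by exists 0 => x feas xB; case: no_x; exists x.
  case: x0 x0B feas0 => g B p q X U V /= -> {B} feas0.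
  have [B_bin [_ [_ [_ [gE B1 _ _]]]]] := feas0.
  have [_ inf_fin] := lp_bounded _ B_bin B1.
  (* The lower bound for the fixed design is the finite optimal value of its flow problem. *)
  have lb X' : lp_feasible P g X' -> fine (optimal_value
      (lp_feasible P (selected_capacity P (design b))) (lp_objective P))
      <= lp_objective P X'.
    move=> feasX'; rewrite -lee_fin fineK //; apply: ereal_inf_lbound.
    by exists X' => //; rewrite /selected_capacity -gE.
  have g_ge0 : 0 <=mx g by rewrite gE; apply: selected_capacity_ge0.
  have [p' [q' [X' [U' [V' [feas' min']]]]]] := mpec_fixed_design_min g_ge0 lb feas0.
  exists (\sum_(k : 'I_nv * 'I_nc) `|G k.1 k.2 * q' k.1 0|).
  move=> [g2 B2 p2 q2 X2 U2 V2] feas2; rewrite [mpec_B _]/= => B2E; subst B2.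
  have g2E : g2 = g by rewrite gE; case: feas2 => _ [_ [_ [_ []]]].
  subst g2; exists (MpecPoint g (design b) p' q' X' U' V'); split=> //.
    exact: min' feas2.
  move=> i j; rewrite (bigD1 (i, j)) //=.
  by apply: le_trans (ler_norm _) _; rewrite lerDl sumr_ge0.
have [m good_m] := choice good_ex.
(* The sum dominates every [m b], and the added 1 makes the constant positive. *)
exists (1 + \sum_b `|m b|); first by rewrite ltr_wpDr ?sumr_ge0.
move=> x feas; pose b : 'M[bool]_(nv, nc) := \matrix_(i, j) (mpec_B x i j == 1).
have xB : mpec_B x = design b.
  apply/matrixP => i j; rewrite !mxE.
  have B_bin : binary_mx (mpec_B x) by case: (x) feas => ? ? ? ? ? ? ? [].
  by case: (B_bin i j) => ->; rewrite ?eqxx // eq_sym oner_eq0.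
have [x' [feas' le_x' bound]] := good_m b x feas xB.
exists x'; split=> // i j; apply: le_trans (bound i j) _.
apply: le_trans (ler_norm _) _; rewrite (bigD1 b) //= addrCA lerDl.
by rewrite addr_ge0 ?sumr_ge0.
Qed.

End Planning.
Theorem mainTheorem4 (R : realType) (nn nv nl nd nc nb : nat)
    (P : planning R nn nv nl nd nc nb)
    (lp_assumption : forall B : 'M[R]_(nv, nc),
       binary_mx B -> B *m ones <=mx ones ->
       lp_feasible_bounded P (selected_capacity P B)) :
  exists2 mu0 : R, 0 < mu0 &
    forall mu : R, mu0 <= mu ->
      optimal_value (mpec_feasible P) (mpec_objective P)
        = optimal_value (milp_feasible P mu) (milp_objective P) /\
      forall (B : 'M[R]_(nv, nc)) (p : 'cV[R]_nl) (q : 'cV[R]_nv)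
             (Y : 'M[R]_(nv, nc)) (X U : 'M[R]_(nl, nd)) (V : 'M[R]_(nn, nd)),
        global_minimizer (milp_feasible P mu) (milp_objective P)
          (MilpPoint B p q Y X U V) ->
        global_minimizer (mpec_feasible P) (mpec_objective P)
          (MpecPoint (selected_capacity P B) B p q X U V).
Proof.
have [mu0 mu0_gt0 bounded] := mpec_bounded_dual_solution lp_assumption.
exists mu0 => // mu le_mu.
(* Together with [milp_to_mpec], this domination gives both inequalities between the infima, also
   over empty feasible sets, and carries minimizers over. *)
have mpec_dom x : mpec_feasible P x ->
    exists2 y, milp_feasible P mu y & milp_objective P y <= mpec_objective P x.
  move=> /bounded [[g B p q X U V] [feas le_x bound]].
  have [i j|Y milp_feas objE] := mpec_to_milp (mu := mu) feas.
    exact: le_trans (bound i j) le_mu.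
  by exists (MilpPoint B p q Y X U V) => //; rewrite objE.
split=> [|B p q Y X U V [feas min_milp]].
  apply/le_anti/andP; split; apply: le_ereal_inf_tmp => _ [x feas <-].
    case: x feas => B p q Y X U V /milp_to_mpec[mpec_feas <-].
    by apply: ereal_inf_lbound; exists (MpecPoint (selected_capacity P B) B p q X U V).
  have [y milp_feas le_yx] := mpec_dom x feas.
  apply: (@le_trans _ _ (milp_objective P y)%:E); last by rewrite lee_fin.
  by apply: ereal_inf_lbound; exists y.
have [mpec_feas objE] := milp_to_mpec feas; split=> // x /mpec_dom[y milp_feas].
by apply: le_trans; rewrite objE; exact: min_milp.
Qed.
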